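(* Let $0\le\delta\le\epsilon<1$, let $F\in M_n(\mathbb{C})$ be a $\delta$-near-symmetric rank-$k$ matrix, and let $X\in\mathbb{C}^{n\times s}$ be a test matrix with $k\le s<n$ orthonormal columns such that $\operatorname{rank}(FX)=k$. Then the diameter of $\Omega_{F,X}^{\epsilon}$ is bounded from below as follows: $$\sup_{A,B\in\Omega_{F,X}^{\epsilon}}\|A-B\|_2\ \ge\ 2\left(\frac{\sigma_{\min}(F)^2}{\sigma_{\max}(F)}\right)\frac{\arccos(1-\epsilon)-\arccos(1-\delta)}{\pi/2+\arccos(1-\epsilon)-\arccos(1-\delta)}.$$
   Context: $\|\cdot\|_2$ is the spectral norm; $\sigma_{\max}$ and $\sigma_{\min}$ denote the largest and the smallest nonzero singular values of a matrix. For a rank-$k$ matrix $A\in M_n(\mathbb{C})$ (with $k\ge 1$), a slim SVD is $A=U_AS_AV_A^*$ with $U_A,V_A\in\mathbb{C}^{n\times k}$ having orthonormal columns and $S_A\in\mathbb{R}^{k\times k}$ diagonal with positive entries. A rank-$k$ matrix $F\in M_n(\mathbb{C})$ with slim SVD $F=U_FS_FV_F^*$ is called $\delta$-near-symmetric if there is a $k\times k$ unitary matrix $Q$ with $\|U_F^*V_F-Q\|_2\le\delta$. For a rank-$k$ matrix $F$ and $X\in\mathbb{C}^{n\times s}$, $$\Omega_{F,X}^{\epsilon}=\{A\in M_n(\mathbb{C}):\ \operatorname{rank}(A)=k,\ AX=FX,\ \exists\, Q\in\mathbb{C}^{k\times k}\text{ unitary with }\|U_A^*V_A-Q\|_2\le\epsilon\},$$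 where $A=U_AS_AV_A^*$ is a slim SVD of $A$. *)

(* Defs.v *)
(* Complex matrices are matrices over R[i], where R : realType. *)
From mathcomp Require Import all_boot all_order all_algebra.
From mathcomp Require Export complex.
From mathcomp Require Import all_classical all_reals all_analysis.

Set Implicit Arguments.
Unset Strict Implicit.
Unset Printing Implicit Defensive.

Import Order.TTheory GRing.Theory Num.Theory.
Local Open Scope classical_set_scope.
Local Open Scope ring_scope.
Local Open Scope complex_scope.
Local Open Scope sesquilinear_scope.

Definition l2norm (R : realType) (n : nat) (x : 'cV[R[i]]_n) : R :=
  Num.sqrt (\sum_(i < n) (ComplexField.Normc.normc (x i 0)) ^+ 2).

(* The closed unit ball contains 0 even when n = 0, so this is the supremum of
   a nonempty bounded set of reals. *)
Definition spectral_norm (R : realType) (m n : nat) (A : 'M[R[i]]_(m, n)) : R :=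
  sup [set l2norm (A *m x) | x in [set x : 'cV[R[i]]_n | l2norm x <= 1]].

(* The singular values of A are the nonnegative square roots of the
   eigenvalues of A^* A. *)
Definition singular_value (R : realType) (m n : nat) (A : 'M[R[i]]_(m, n))
    (s : R) : Prop :=
  0 <= s /\ eigenvalue (A^t* *m A) (s ^+ 2)%:C.

(* There are finitely many singular values, so for A != 0 the supremum and
   infimum below are a maximum and a minimum. *)
Definition sigma_max (R : realType) (m n : nat) (A : 'M[R[i]]_(m, n)) : R :=
  sup [set s | singular_value A s].

Definition sigma_min (R : realType) (m n : nat) (A : 'M[R[i]]_(m, n)) : R :=
  inf [set s | singular_value A s /\ s != 0].

Definition orthonormal_cols (R : realType) (m n : nat)
    (A : 'M[R[i]]_(m, n)) : Prop :=
  A^t* *m A = 1%:M.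

(* The row d lists the diagonal of the factor S_A. *)
Definition slim_svd (R : realType) (n k : nat) (A : 'M[R[i]]_n)
    (U : 'M[R[i]]_(n, k)) (d : 'rV[R]_k) (V : 'M[R[i]]_(n, k)) : Prop :=
  [/\ orthonormal_cols U, orthonormal_cols V, (forall i, 0 < d 0 i) &
      A = U *m diag_mx (map_mx (real_complex R) d) *m V^t*].

(* A slim SVD is not unique, but two of them differ by a common k x k unitary
   factor on U and V, so the choice of SVD does not matter. *)
Definition near_symmetric (R : realType) (n k : nat) (delta : R)
    (A : 'M[R[i]]_n) : Prop :=
  \rank A = k /\
  exists (U : 'M[R[i]]_(n, k)) (d : 'rV[R]_k) (V : 'M[R[i]]_(n, k)),
    slim_svd A U d V /\
    exists Q : 'M[R[i]]_k,
      Q \is unitarymx /\ spectral_norm (U^t* *m V - Q) <= delta.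

Definition Omega (R : realType) (n k s : nat) (F : 'M[R[i]]_n)
    (X : 'M[R[i]]_(n, s)) (epsilon : R) : set 'M[R[i]]_n :=
  [set A | \rank A = k /\ A *m X = F *m X /\
     exists (U : 'M[R[i]]_(n, k)) (d : 'rV[R]_k) (V : 'M[R[i]]_(n, k)),
       slim_svd A U d V /\
       exists Q : 'M[R[i]]_k,
         Q \is unitarymx /\ spectral_norm (U^t* *m V - Q) <= epsilon].

(* Extended-real valued: the diameter of an unbounded set is +oo. *)
Definition diameter (R : realType) (m n : nat) (S : set 'M[R[i]]_(m, n)) :
    \bar R :=
  ereal_sup [set (spectral_norm (p.1 - p.2))%:E | p in S `*` S].

(* Main.v *)
(* Fix a slim SVD F = U S V^*. For y in the kernel of X^*, the matrix
   A = U (V S + y e_i^* )^* agrees with F on X and has the column space of F, so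
   A is in Omega iff every unit vector of the column space W of V S + y e_i^*
   makes an angle at most arccos(1 - epsilon) with the column space of U. The
   column space of V is within angle arccos(1 - delta) of that of U, and that
   of W within angle a = arccos(1 - epsilon) - arccos(1 - delta) of that of V as
   soon as |y| <= sin(a) (c - |y|), where c > 0 is a lower bound for the
   diagonal of S, such as sigma_min^2 / sigma_max. Jordan's inequality
   sin(a) >= 2 a / pi allows |y| = c a / (pi / 2 + a), and the two matrices given
   by y and -y are at distance 2 |y|. *)
Require Import Defs.
From mathcomp Require Import all_boot all_order all_algebra.
From mathcomp Require Import all_classical all_reals all_analysis.
From mathcomp Require Import ring lra.

Set Implicit Arguments.
Unset Strict Implicit.
Unset Printing Implicit Defensive.

Import Order.TTheory GRing.Theory Num.Theory.
Import numFieldNormedType.Exports.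
Local Open Scope classical_set_scope.
Local Open Scope ring_scope.
Local Open Scope complex_scope.
Local Open Scope sesquilinear_scope.

(** * Hermitian inner product and Euclidean norm of column vectors *)

Definition cdot (R : realType) n (x y : 'cV[R[i]]_n) : R[i] := (x^t* *m y) 0 0.

Lemma l2norm_ge0 (R : realType) n (x : 'cV[R[i]]_n) : 0 <= l2norm x.
Proof. exact: sqrtr_ge0. Qed.

Lemma cdotxx (R : realType) n (x : 'cV[R[i]]_n) :
  cdot x x = (l2norm x ^+ 2)%:C.
Proof.
rewrite /l2norm sqr_sqrtr; last by apply: sumr_ge0 => i _; exact: sqr_ge0.
rewrite /cdot mxE rmorph_sum; apply: eq_bigr => i _.
rewrite !mxE mulrC -normCK rmorphXn; congr (_ ^+ 2).
Qed.

Lemma l2norm_cdot (R : realType) m n (x : 'cV[R[i]]_m) (y : 'cV[R[i]]_n) :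
  cdot x x = cdot y y -> l2norm x = l2norm y.
Proof.
rewrite !cdotxx => /complexI /eqP.
by rewrite eqrXn2 ?l2norm_ge0 // => /eqP.
Qed.

Lemma cdotMl (R : realType) m n (A : 'M[R[i]]_(m, n)) x y :
  cdot (A *m x) y = cdot x (A^t* *m y).
Proof. by rewrite /cdot trmx_mul map_mxM mulmxA. Qed.

Lemma cdotDr (R : realType) n (x y z : 'cV[R[i]]_n) :
  cdot x (y + z) = cdot x y + cdot x z.
Proof. by rewrite /cdot mulmxDr mxE. Qed.

Lemma cdotDl (R : realType) n (x y z : 'cV[R[i]]_n) :
  cdot (y + z) x = cdot y x + cdot z x.
Proof. by rewrite /cdot linearD map_mxD mulmxDl mxE. Qed.

Lemma cdotZr (R : realType) n a (x y : 'cV[R[i]]_n) :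
  cdot x (a *: y) = a * cdot x y.
Proof. by rewrite /cdot -scalemxAr mxE. Qed.

Lemma cdotZl (R : realType) n a (x y : 'cV[R[i]]_n) :
  cdot (a *: x) y = conjc a * cdot x y.
Proof. by rewrite /cdot linearZ map_mxZ -scalemxAl mxE. Qed.

Lemma cdotC (R : realType) n (x y : 'cV[R[i]]_n) : cdot y x = conjc (cdot x y).
Proof.
rewrite /cdot !mxE rmorph_sum; apply: eq_bigr => i _.
by rewrite !mxE rmorphM /= conjcK mulrC.
Qed.

Lemma l2norm_isom (R : realType) m n (A : 'M[R[i]]_(m, n)) x :
  orthonormal_cols A -> l2norm (A *m x) = l2norm x.
Proof.
by move=> AA; apply: l2norm_cdot; rewrite cdotMl mulmxA AA mul1mx.
Qed.

Lemma CauchySchwarz_l2norm (R : realType) n (x y : 'cV[R[i]]_n) :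
  `|cdot x y| <= (l2norm x * l2norm y)%:C.
Proof.
have l2sq (z : 'cV[R[i]]_n) : (l2norm z)%:C ^+ 2 = cdot z z.
  by rewrite cdotxx rmorphXn.
have xy0 : 0 <= (l2norm x * l2norm y)%:C by rewrite ler0c mulr_ge0 ?l2norm_ge0.
rewrite -(@ler_pXn2r _ 2) ?nnegrE // rmorphM exprMn !l2sq.
have : `|dotmx (x^t*) (y^t*)| ^+ 2 <= dotmx (x^t*) (x^t*) * dotmx (y^t*) (y^t*).
  exact: (CauchySchwarz (@dotmx R[i] n) (x^t*) (y^t*)).1.
by rewrite !dotmxE !trmxCK.
Qed.

Lemma l2normD (R : realType) n (x y : 'cV[R[i]]_n) :
  l2norm (x + y) <= l2norm x + l2norm y.
Proof.
rewrite -(@ler_pXn2r _ 2) ?nnegrE ?addr_ge0 ?l2norm_ge0 //.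
rewrite -lecR -cdotxx cdotDl !cdotDr !cdotxx.
(* The two cross terms are bounded together because only their sum is real, and the order on [R[i]]
   compares numbers with equal imaginary part. *)
have H : cdot x y + cdot y x <= ((l2norm x * l2norm y) *+ 2)%:C.
  apply: le_trans (real_ler_norm _) _.
    by rewrite [cdot y x]cdotC addcJ rpredM ?realn ?complex_real.
  apply: le_trans (ler_normD _ _) _.
  rewrite mulr2n rmorphD lerD ?CauchySchwarz_l2norm // mulrC.
  exact: CauchySchwarz_l2norm.
rewrite sqrrD addrAC !rmorphD /= -!addrA lerD2l !addrA.
by rewrite addrAC lerD2r addrC; move: H; rewrite mulr2n rmorphD.
Qed.

Lemma l2norm_eq0 (R : realType) n (x : 'cV[R[i]]_n) : l2norm x = 0 -> x = 0.
Proof.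
move=> x0; apply/eqP; rewrite -[x]trmxCK.
have: dotmx (x^t*) (x^t*) == 0.
  by rewrite dotmxE trmxCK -[_ 0 0]/(cdot x x) cdotxx x0 expr0n.
by rewrite dnorm_eq0 => /eqP ->; rewrite linear0 map_mx0.
Qed.

Lemma l2normZ (R : realType) n (a : R) (x : 'cV[R[i]]_n) :
  l2norm (a%:C *: x) = `|a| * l2norm x.
Proof.
apply/eqP; rewrite -(@eqrXn2 _ 2) ?mulr_ge0 ?l2norm_ge0 //; apply/eqP.
apply: complexI.
rewrite -cdotxx cdotZl cdotZr cdotxx conjc_real mulrA.
by rewrite exprMn real_normK ?num_real // !rmorphM.
Qed.

Lemma l2norm0 (R : realType) n : l2norm (0 : 'cV[R[i]]_n) = 0.
Proof. by have := l2normZ 0 (0 : 'cV[R[i]]_n); rewrite scaler0 normr0 mul0r. Qed.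

(** * Jordan's inequality for the sine *)

Lemma jordan_sin (R : realType) (x : R) :
  0 <= x -> x <= pi / 2 -> x <= sin x * (pi / 2).
Proof.
move=> x0 x1.
have [->|xn0] := eqVneq x 0; first by rewrite sin0 mul0r.
have [->|xn1] := eqVneq x (pi / 2); first by rewrite sin_pihalf mul1r.
have {xn0}x0' : 0 < x by rewrite lt0r xn0.
have {xn1}x1' : x < pi / 2 by rewrite lt_neqAle xn1.
have ds (z : R) : is_derive z 1 (@sin R) (cos z) by exact: is_derive_sin.
have cs (A : set R) : {within A, continuous (@sin R)}.
  by apply: continuous_subspaceT => z; exact: continuous_sin.
(* Concavity by hand: the chord slopes of [sin] over [0, x] and [x, pi/2] are [cos a] and [cos b]
   with a < x < b, so the first is the larger. Cross-multiplied, this is the claim. *)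
have [a] := MVT x0' (fun z _ => ds z) (@cs _).
rewrite in_itv /= => /andP[a0 ax].
have [b] := MVT x1' (fun z _ => ds z) (@cs _).
rewrite in_itv /= => /andP[xb b1].
rewrite sin_pihalf sin0 !subr0 => eb ea.
have pi2 : pi / 2 <= (pi : R) by have := @pi_gt0 R; lra.
have cba : cos b <= cos a.
  by apply: ltW; rewrite ltr_cos ?in_itv /=; lra.
have h : cos b * (pi / 2 - x) * x <= cos a * x * (pi / 2 - x).
  by rewrite -mulrA -mulrA [x * _]mulrC ler_wpM2r // mulr_ge0 //; lra.
rewrite -eb -ea in h.
lra.
Qed.

(** * The spectral norm as an operator norm *)

Lemma l2norm_mulmx_bounded (R : realType) m n (A : 'M[R[i]]_(m, n)) :
  exists c : R, forall x, l2norm x <= 1 -> l2norm (A *m x) <= c.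
Proof.
(* The Frobenius norm of [A] serves as bound, by Cauchy-Schwarz on each row. *)
exists (Num.sqrt (\sum_(i < m) l2norm ((row i A)^t*) ^+ 2)) => x x1.
rewrite ler_wsqrtr //; apply: ler_sum => i _.
rewrite lerXn2r ?nnegrE ?l2norm_ge0 //.
  by rewrite -lecR; exact: (normr_ge0 ((A *m x) i 0)).
have -> : (A *m x) i 0 = cdot ((row i A)^t*) x.
  by rewrite /cdot trmxCK -row_mul [RHS]mxE.
suff h : ComplexField.Normc.normc (cdot ((row i A)^t*) x) <=
    l2norm ((row i A)^t*) * l2norm x.
  by apply: le_trans h _; rewrite ler_piMr ?l2norm_ge0.
by rewrite -lecR; exact: CauchySchwarz_l2norm.
Qed.

Lemma spectral_norm_le (R : realType) m n (A : 'M[R[i]]_(m, n)) c :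
  (forall x, l2norm x <= 1 -> l2norm (A *m x) <= c) -> spectral_norm A <= c.
Proof.
move=> Ac; apply: ge_sup; last by move=> _ [x /= x1 <-]; exact: Ac.
exists (l2norm (A *m 0)), 0 => //=.
by rewrite l2norm0.
Qed.

Lemma le_spectral_norm (R : realType) m n (A : 'M[R[i]]_(m, n)) x :
  l2norm x <= 1 -> l2norm (A *m x) <= spectral_norm A.
Proof.
move=> x1; apply: ub_le_sup; last by exists x.
by have [c Ac] := l2norm_mulmx_bounded A; exists c => _ [y /= y1 <-]; exact: Ac.
Qed.

Lemma l2norm_mulmx_le (R : realType) m n (A : 'M[R[i]]_(m, n)) x :
  l2norm (A *m x) <= spectral_norm A * l2norm x.
Proof.
have [x0|x0] := eqVneq (l2norm x) 0.
  by rewrite x0 mulr0 (l2norm_eq0 x0) mulmx0 l2norm0.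
have xgt0 : 0 < l2norm x by rewrite lt0r x0 l2norm_ge0.
rewrite -ler_pdivrMr // mulrC -[(l2norm x)^-1]ger0_norm ?invr_ge0 ?l2norm_ge0 //.
rewrite -l2normZ scalemxAr le_spectral_norm // l2normZ.
by rewrite ger0_norm ?invr_ge0 ?l2norm_ge0 // mulVf.
Qed.

(** * Gram matrices, slim SVDs and nearest unitary matrices *)

Lemma gram_diag (R : realType) m k (M : 'M[R[i]]_(m, k)) :
  exists (P : 'M[R[i]]_k) (d : 'rV[R]_k),
    [/\ P \is unitarymx,
        forall i, d 0 i = l2norm (M *m (P^t* *m delta_mx i 0)) &
        M^t* *m M = P^t* *m (diag_mx (map_mx (real_complex R) d) *m
          diag_mx (map_mx (real_complex R) d)) *m P].
Proof.
have [P [sp [PU GE]]] : exists (P : 'M[R[i]]_k) (sp : 'rV[R[i]]_k),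
    P \is unitarymx /\ M^t* *m M = P^t* *m diag_mx sp *m P.
  exists (spectralmx (M^t* *m M)), (spectral_diag (M^t* *m M)).
  split; first exact: spectral_unitarymx.
  rewrite -invmx_unitary ?spectral_unitarymx //.
  apply/orthomx_spectralP/normalmxP.
  by rewrite trmx_mul map_mxM trmxCK.
have PP : P *m P^t* = 1%:M by exact/unitarymxP.
pose d : 'rV[R]_k := \row_i l2norm (M *m (P^t* *m delta_mx i 0)).
(* Each eigenvalue of the Gram matrix is the squared norm of the image under [M] of the unit
   eigenvector [P^t* *m delta_mx i 0], hence the square of a real number. *)
have spE : sp = \row_i ((d 0 i)%:C * (d 0 i)%:C).
  apply/rowP => i; rewrite !mxE.
  pose x : 'cV_m := M *m (P^t* *m delta_mx i 0).
  transitivity (cdot x x); last by rewrite cdotxx expr2 rmorphM.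
  rewrite /x cdotMl mulmxA GE cdotMl trmxCK !mulmxA PP mul1mx.
  rewrite -[_ *m P *m _]mulmxA PP mulmx1.
  by rewrite /cdot trmx_delta map_delta_mx -rowE -colE !mxE eqxx mulr1n.
exists P, d; split => // [i|]; first by rewrite mxE.
rewrite GE spE mulmx_diag; congr (_ *m diag_mx _ *m _).
by apply/rowP => i; rewrite !mxE.
Qed.

Lemma diag_real_inv (R : realType) k (d : 'rV[R]_k) : (forall i, 0 < d 0 i) ->
  exists E : 'M[R[i]]_k, [/\ E^t* = E,
    diag_mx (map_mx (real_complex R) d) *m E = 1%:M &
    E *m diag_mx (map_mx (real_complex R) d) = 1%:M].
Proof.
move=> d0; exists (diag_mx (map_mx (real_complex R) (map_mx GRing.inv d))).
have DE : diag_mx (map_mx (real_complex R) d) *m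
    diag_mx (map_mx (real_complex R) (map_mx GRing.inv d)) = 1%:M.
  rewrite mulmx_diag -diag_const_mx; congr diag_mx.
  by apply/rowP => i; rewrite !mxE -rmorphM mulfV ?gt_eqF.
split => //; last exact: mulmx1C.
rewrite tr_diag_mx map_diag_mx; congr diag_mx.
by apply/rowP => i; rewrite !mxE; exact: conjc_real.
Qed.

Lemma l2norm_delta (R : realType) k (i : 'I_k) :
  l2norm (delta_mx i 0 : 'cV[R[i]]_k) = 1.
Proof.
apply/eqP; rewrite -(@eqrXn2 _ 2) ?l2norm_ge0 // expr1n; apply/eqP/complexI.
by rewrite -cdotxx /cdot trmx_delta map_delta_mx -rowE !mxE !eqxx.
Qed.

Lemma trmxC_mul (R : realType) m n p (A : 'M[R[i]]_(m, n)) (B : 'M[R[i]]_(n, p)) :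
  (A *m B)^t* = (B^t*) *m (A^t*).
Proof. by rewrite trmx_mul map_mxM. Qed.

Lemma unitarymx_cols (R : realType) k (P : 'M[R[i]]_k) :
  P \is unitarymx -> P^t* *m P = 1%:M.
Proof. by move=> /unitarymxP/mulmx1C. Qed.

(** If C^* C = P^* D^2 P, then B = P^* D^-1 makes the columns of C B orthonormal, and C^* = P^* D (C
    B)^*. The lower bound on [C] makes D invertible. The left factor [U *m P^t*] keeps the column
    space of [U]. *)
Lemma slim_svd_factor (R : realType) n k (U C : 'M[R[i]]_(n, k)) (c : R) :
  orthonormal_cols U -> 0 < c ->
  (forall z, c * l2norm z <= l2norm (C *m z)) ->
  exists (P B : 'M[R[i]]_k) (d : 'rV[R]_k),
    P \is unitarymx /\ slim_svd (U *m C^t*) (U *m P^t*) d (C *m B).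
Proof.
move=> UU c0 Cc; have [P [d [PU dE CC]]] := gram_diag C.
have PP : P *m P^t* = 1%:M by exact/unitarymxP.
have PP' := unitarymx_cols PU.
have d0 i : 0 < d 0 i.
  rewrite dE; apply: lt_le_trans (Cc _).
  by rewrite l2norm_isom ?l2norm_delta ?mulr1 // /orthonormal_cols trmxCK.
set D := diag_mx _ in CC.
have [E [EC DE ED]] := diag_real_inv d0.
rewrite -/D in DE ED.
exists P, (P^t* *m E), d; split => //; split => //; rewrite /orthonormal_cols.
- by rewrite trmxC_mul trmxCK mulmxA -[_ *m _ *m U]mulmxA UU mulmx1.
- rewrite trmxC_mul -mulmxA (mulmxA (C^t*)) CC.
  rewrite trmxC_mul trmxCK EC !mulmxA.
  rewrite -[_ *m P *m _]mulmxA PP mulmx1 -[_ *m P *m _]mulmxA PP mulmx1.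
  by rewrite ED mul1mx DE.
- rewrite -/D !trmxC_mul trmxCK EC !mulmxA.
  by rewrite -[_ *m D *m E]mulmxA DE mulmx1 -[_ *m _ *m P]mulmxA PP' mulmx1.
Qed.

Lemma slim_svd_rank (R : realType) n k (A : 'M[R[i]]_n) U (d : 'rV[R]_k) V :
  slim_svd A U d V -> \rank A = k.
Proof.
move=> [UU VV d0 AE]; apply/eqP; rewrite eqn_leq; apply/andP; split.
  by rewrite AE -mulmxA; exact: leq_trans (mxrankM_maxl _ _) (rank_leq_col _).
set D := diag_mx _ in AE.
have <- : \rank D = k.
  by apply: mxrank_unit; have [E [_ /mulmx1_unit[]]] := diag_real_inv d0.
have -> : D = U^t* *m A *m V.
  by rewrite AE !mulmxA UU mul1mx -mulmxA VV mulmx1.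
exact: leq_trans (mxrankM_maxl _ _) (mxrankM_maxr _ _).
Qed.

Lemma l2norm_diag_le (R : realType) k (d : 'rV[R]_k) (c : R) x :
  0 <= c -> (forall i, `|d 0 i| <= c) ->
  l2norm (diag_mx (map_mx (real_complex R) d) *m x) <= c * l2norm x.
Proof.
move=> c0 dc; rewrite -(@ler_pXn2r _ 2) ?nnegrE ?mulr_ge0 ?l2norm_ge0 //.
rewrite exprMn /l2norm !sqr_sqrtr; try by apply: sumr_ge0 => i _; exact: sqr_ge0.
rewrite mulr_sumr; apply: ler_sum => i _.
rewrite mul_diag_mx !mxE ComplexField.Normc.normcM exprMn ler_wpM2r ?sqr_ge0 //.
rewrite /= expr0n addr0 sqrtr_sqr real_normK ?num_real // -real_normK ?num_real //.
by rewrite lerXn2r ?nnegrE.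
Qed.

(** The singular values of [M] lie in [1 - eps, 1], so its unitary polar factor is within [eps] of
    it. For M = U^* V this turns an angle bound between two column spaces into near-symmetry. *)
Lemma near_unitary (R : realType) k (M : 'M[R[i]]_k) (eps : R) :
  0 <= eps -> eps < 1 ->
  (forall z, (1 - eps) * l2norm z <= l2norm (M *m z)) ->
  (forall z, l2norm (M *m z) <= l2norm z) ->
  exists Q, Q \is unitarymx /\ spectral_norm (M - Q) <= eps.
Proof.
move=> e0 e1 Ml Mu; have [P [d [PU dE MM]]] := gram_diag M.
have PP : P *m P^t* = 1%:M by exact/unitarymxP.
have PP' := unitarymx_cols PU.
have nP i : l2norm (P^t* *m delta_mx i 0) = 1.
  by rewrite l2norm_isom ?l2norm_delta // /orthonormal_cols trmxCK.
have d1 i : 1 - eps <= d 0 i.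
  by rewrite dE; have := Ml (P^t* *m delta_mx i 0); rewrite nP mulr1.
have d2 i : d 0 i <= 1.
  by rewrite dE; have := Mu (P^t* *m delta_mx i 0); rewrite nP.
have d0 i : 0 < d 0 i by apply: lt_le_trans (d1 i); rewrite subr_gt0.
set D := diag_mx _ in MM.
have [E [EC DE ED]] := diag_real_inv d0.
(* [P^t* *m E *m P] is the inverse square root of M^* M, so [Q] is the polar factor of [M]. *)
rewrite -/D in DE ED; pose Q := M *m (P^t* *m E *m P).
have QQ : Q^t* *m Q = 1%:M.
  rewrite trmxC_mul -mulmxA (mulmxA (M^t*)) MM.
  rewrite !trmxC_mul trmxCK EC !mulmxA.
  rewrite -[_ *m P *m _]mulmxA PP mulmx1 -[_ *m P *m _]mulmxA PP mulmx1.
  by rewrite -[_ *m E *m D]mulmxA ED mulmx1 -[_ *m D *m E]mulmxA DE mulmx1.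
exists Q; split; first by apply/unitarymxP/mulmx1C.
(* M - Q = Q (|M| - 1), where |M| = P^* D P. *)
have MQ : M - Q =
    Q *m (P^t* *m (diag_mx (map_mx (real_complex R) (d - const_mx 1)) *m P)).
  rewrite map_mxB linearB /= -/D map_const_mx rmorph1 diag_const_mx mulmxBl mul1mx.
  rewrite mulmxBr PP' mulmxBr mulmx1; congr (_ - _).
  rewrite /Q !mulmxA -[_ *m P *m _]mulmxA PP mulmx1 -[_ *m E *m D]mulmxA ED mulmx1.
  by rewrite -mulmxA PP' mulmx1.
apply: spectral_norm_le => x x1.
rewrite MQ -mulmxA l2norm_isom // -mulmxA l2norm_isom; last first.
  by rewrite /orthonormal_cols trmxCK.
rewrite -mulmxA.
apply: le_trans (l2norm_diag_le (c := eps) _ _ _) _ => // [i|].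
  by rewrite !mxE ler_norml; have := d1 i; have := d2 i; lra.
by rewrite l2norm_isom // -[leRHS]mulr1 ler_wpM2l.
Qed.

(** * Orthogonal projections and angles between subspaces *)

Lemma cdot_eq0C (R : realType) n (x y : 'cV[R[i]]_n) :
  cdot x y = 0 -> cdot y x = 0.
Proof. by move=> xy; rewrite cdotC xy conjc0. Qed.

Lemma l2norm_pythagoras (R : realType) n (x y : 'cV[R[i]]_n) :
  cdot x y = 0 -> l2norm (x + y) ^+ 2 = l2norm x ^+ 2 + l2norm y ^+ 2.
Proof.
move=> xy; apply: complexI; rewrite -cdotxx cdotDl !cdotDr xy (cdot_eq0C xy).
by rewrite addr0 add0r !cdotxx rmorphD.
Qed.

Lemma coisom_pythagoras (R : realType) n k (U : 'M[R[i]]_(n, k)) x :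
  orthonormal_cols U ->
  l2norm x ^+ 2 =
  l2norm (U^t* *m x) ^+ 2 + l2norm (x - U *m (U^t* *m x)) ^+ 2.
Proof.
move=> UU; rewrite -(l2norm_isom (U^t* *m x) UU) -l2norm_pythagoras.
  by rewrite addrC subrK.
by rewrite cdotMl mulmxBr !mulmxA UU mul1mx subrr /cdot mulmx0 mxE.
Qed.

Lemma coisom_contract (R : realType) n k (U : 'M[R[i]]_(n, k)) x :
  orthonormal_cols U -> l2norm (U^t* *m x) <= l2norm x.
Proof.
move=> UU; rewrite -(@ler_pXn2r _ 2) ?nnegrE ?l2norm_ge0 //.
by rewrite (coisom_pythagoras x UU) lerDl sqr_ge0.
Qed.

Lemma coisom_residual (R : realType) n k (U : 'M[R[i]]_(n, k)) x :
  orthonormal_cols U -> l2norm (x - U *m (U^t* *m x)) <= l2norm x.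
Proof.
move=> UU; rewrite -(@ler_pXn2r _ 2) ?nnegrE ?l2norm_ge0 //.
by rewrite (coisom_pythagoras x UU) lerDr sqr_ge0.
Qed.

(** Triangle inequality for angles: if p + q makes an angle at most alpha with p, and p an angle at
    most beta with the column space of [U], the angles add up. With [ca], [sa] and [cb], [sb] the
    cosines and sines of alpha and beta, the factor on the left is cos(alpha + beta). *)
Lemma coisom_angle (R : realType) n k (U : 'M[R[i]]_(n, k)) (p q : 'cV[R[i]]_n)
    (ca sa cb sb : R) :
  orthonormal_cols U -> cdot p q = 0 ->
  0 < ca -> 0 <= sa -> 0 < cb -> 0 <= sb ->
  ca ^+ 2 + sa ^+ 2 = 1 -> cb ^+ 2 + sb ^+ 2 = 1 ->
  l2norm q <= sa * l2norm (p + q) ->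
  cb * l2norm p <= l2norm (U^t* *m p) ->
  (ca * cb - sa * sb) * l2norm (p + q) <= l2norm (U^t* *m (p + q)).
Proof.
move=> UU pq ca0 sa0 cb0 sb0 ca1 cb1 qv pU.
set v := p + q in qv *.
have pv : ca * l2norm v <= l2norm p.
  rewrite -(@ler_pXn2r _ 2) ?nnegrE ?mulr_ge0 ?l2norm_ge0 //; last exact: ltW.
  have := l2norm_pythagoras pq; rewrite -/v => vE.
  have : l2norm q ^+ 2 <= (sa * l2norm v) ^+ 2.
    by rewrite lerXn2r ?nnegrE ?mulr_ge0 ?l2norm_ge0.
  rewrite !exprMn; have -> : sa ^+ 2 = 1 - ca ^+ 2 by rewrite -ca1 addrC addKr.
  lra.
have [v0|v0] := eqVneq (l2norm v) 0; first by rewrite v0 mulr0 l2norm_ge0.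
have {}v0 : 0 < l2norm v by rewrite lt0r v0 l2norm_ge0.
have p0 : 0 < l2norm p by apply: lt_le_trans pv; rewrite mulr_gt0.
set x := U^t* *m p in pU.
have x0 : 0 < l2norm x by apply: lt_le_trans pU; rewrite mulr_gt0.
(* [c%:C *: p] is the orthogonal projection of [U *m x] onto the line of [p], and [r] is what
   remains; [rE] bounds [r] by the sine of beta. *)
pose c := l2norm x ^+ 2 / l2norm p ^+ 2.
pose r := U *m x - c%:C *: p.
have Uxp : cdot (U *m x) p = (l2norm x ^+ 2)%:C by rewrite cdotMl -/x cdotxx.
have rp : cdot (c%:C *: p) r = 0.
  rewrite cdotZl /r cdotDr -scaleNr cdotZr cdotxx (cdotC (U *m x)) Uxp.
  rewrite [conjc (l2norm x ^+ 2)%:C]conjc_real -rmorphN -rmorphM /c -mulNr.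
  by rewrite mulfVK ?expf_neq0 ?gt_eqF // rmorphN /= subrr mulr0.
have rE : l2norm r <= sb * l2norm x.
  rewrite -(@ler_pXn2r _ 2) ?nnegrE ?mulr_ge0 ?l2norm_ge0 //.
  have := l2norm_pythagoras rp; rewrite addrC subrK l2norm_isom // l2normZ.
  rewrite !exprMn real_normK ?num_real // => xE.
  have -> : sb ^+ 2 = 1 - cb ^+ 2 by rewrite -cb1 addrC addKr.
  suff : cb ^+ 2 * l2norm x ^+ 2 <= c ^+ 2 * l2norm p ^+ 2 by lra.
  have -> : c ^+ 2 * l2norm p ^+ 2 = c * l2norm x ^+ 2.
    by rewrite /c; field; rewrite gt_eqF.
  rewrite ler_wpM2r ?sqr_ge0 // ler_pdivlMr ?exprn_gt0 // -exprMn.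
  by rewrite lerXn2r ?nnegrE ?mulr_ge0 ?l2norm_ge0 // ltW.
(* Since [q] is orthogonal to [p], it meets only the component [r] of [U *m x]. *)
have xv : cdot x (U^t* *m v) = (l2norm x ^+ 2)%:C + cdot r q.
  rewrite -cdotMl /v cdotDr Uxp; congr (_ + _).
  by rewrite -[U *m x](subrK (c%:C *: p)) cdotDl cdotZl pq mulr0 addr0.
have main : l2norm x ^+ 2 <= l2norm x * l2norm (U^t* *m v) + l2norm r * l2norm q.
  have : `|(l2norm x ^+ 2)%:C| <=
      (l2norm x * l2norm (U^t* *m v) + l2norm r * l2norm q)%:C.
    rewrite -[X in `|X|](addrK (cdot r q)) -xv rmorphD.
    by apply: le_trans (ler_normB _ _) _; rewrite lerD ?CauchySchwarz_l2norm.
  by rewrite ger0_norm ?ler0c ?sqr_ge0 // lecR.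
rewrite -(ler_pM2l x0).
have h1 : l2norm r * l2norm q <= (sb * l2norm x) * (sa * l2norm v).
  by rewrite ler_pM ?l2norm_ge0.
have h2 : l2norm x * (cb * (ca * l2norm v)) <= l2norm x * l2norm x.
  rewrite ler_wpM2l ?l2norm_ge0 //; apply: le_trans pU.
  by rewrite ler_wpM2l // ltW.
lra.
Qed.

Lemma l2norm_diag_ge (R : realType) k (d : 'rV[R]_k) (c : R) x :
  0 <= c -> (forall i, c <= d 0 i) ->
  c * l2norm x <= l2norm (diag_mx (map_mx (real_complex R) d) *m x).
Proof.
move=> c0 dc; rewrite -(@ler_pXn2r _ 2) ?nnegrE ?mulr_ge0 ?l2norm_ge0 //.
rewrite exprMn /l2norm !sqr_sqrtr; try by apply: sumr_ge0 => i _; exact: sqr_ge0.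
rewrite mulr_sumr; apply: ler_sum => i _.
rewrite mul_diag_mx !mxE ComplexField.Normc.normcM exprMn ler_wpM2r ?sqr_ge0 //.
rewrite /= expr0n addr0 sqrtr_sqr real_normK ?num_real //.
by rewrite lerXn2r ?nnegrE // (le_trans c0).
Qed.

(** * Singular values read off a slim SVD *)

Lemma slim_svd_gram (R : realType) n k (A : 'M[R[i]]_n) U (d : 'rV[R]_k) V :
  slim_svd A U d V ->
  A^t* *m A = V *m diag_mx (\row_i (d 0 i ^+ 2)%:C) *m V^t*.
Proof.
move=> [UU VV d0 ->]; rewrite !trmxC_mul trmxCK tr_diag_mx map_diag_mx !mulmxA.
rewrite -[_ *m U^t* *m U]mulmxA UU mulmx1; congr (_ *m _).
rewrite -[LHS]mulmxA mulmx_diag; congr (_ *m diag_mx _).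
apply/rowP => i; rewrite !mxE [X in X * _]conjc_real.
by rewrite expr2 rmorphM.
Qed.

Lemma singular_value_svd (R : realType) n k (A : 'M[R[i]]_n) U (d : 'rV[R]_k) V i :
  slim_svd A U d V -> singular_value A (d 0 i).
Proof.
move=> Asvd; have AA := slim_svd_gram Asvd; case: Asvd => UU VV d0 AE.
split; first exact: ltW; apply/eigenvalueP.
(* [eigenvalue] is about row eigenvectors, so the adjoint of the [i]-th column of [V] is taken. *)
exists (delta_mx 0 i *m V^t*); last first.
  apply/eqP => /(congr1 (fun v => (v *m V) 0 i)) /eqP.
  by rewrite -mulmxA VV mulmx1 mul0mx !mxE !eqxx oner_eq0.
rewrite AA !mulmxA -[_ *m _ *m V]mulmxA VV mulmx1 scalemxAl; congr (_ *m _).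
rewrite -rowE; apply/rowP => j; rewrite !mxE.
by case: eqVneq => [->|]; rewrite ?eqxx ?mulr1 ?mulr0n ?mulr0.
Qed.

Lemma singular_value_mem (R : realType) n k (A : 'M[R[i]]_n) U (d : 'rV[R]_k) V s :
  slim_svd A U d V -> singular_value A s -> s != 0 -> exists i, s = d 0 i.
Proof.
move=> Asvd; have AA := slim_svd_gram Asvd; case: Asvd => UU VV d0 AE.
move=> [s0 /eigenvalueP[v]]; rewrite AA => vE v0 sn0.
have sC : (s ^+ 2)%:C != 0 :> R[i].
  by rewrite -(rmorph0 (real_complex R)) (inj_eq (@complexI R)) expf_neq0.
have wE : (v *m V) *m diag_mx (\row_i (d 0 i ^+ 2)%:C) = (s ^+ 2)%:C *: (v *m V).
  have := congr1 (mulmx^~ V) vE; rewrite -scalemxAl !mulmxA => <-.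
  by rewrite -[RHS]mulmxA VV mulmx1.
(* If v V were zero, the eigenvalue equation would give s^2 v = 0 with s and v nonzero. *)
have [j wj] : exists j, (v *m V) 0 j != 0.
  apply/existsP; apply: contraNT v0; rewrite negb_exists => /forallP w0.
  have {}w0 : v *m V = 0 by apply/rowP => j; rewrite [RHS]mxE; exact/eqP/negPn.
  have := vE; rewrite !mulmxA w0 !mul0mx => /esym/eqP.
  by rewrite scaler_eq0 (negPf sC).
exists j; have /rowP/(_ j) := wE.
rewrite mul_mx_diag; move: (v *m V) wj => w wj; rewrite !mxE mulrC => /(mulIf wj).
move=> /complexI h; apply/eqP.
by rewrite -(@eqrXn2 _ 2) ?(ltW (d0 _)) // h.
Qed.

(** Both sigma_min <= d_i and sigma_min <= sigma_max hold, and sigma_min^2 <= d_i sigma_max follows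
    by multiplying them. *)
Lemma sigma_ratio_bounds (R : realType) n k (A : 'M[R[i]]_n) U (d : 'rV[R]_k) V (i : 'I_k) :
  slim_svd A U d V ->
  0 <= sigma_min A ^+ 2 / sigma_max A <= d 0 i.
Proof.
move=> Asvd; have d0 : 0 < d 0 i by case: Asvd.
have sd := singular_value_svd i Asvd.
have m0 : 0 <= sigma_min A.
  by apply: lb_le_inf => [|s [[]]//]; exists (d 0 i); split; rewrite ?gt_eqF.
have mi : sigma_min A <= d 0 i.
  apply: ge_inf; first by exists 0 => s [[]].
  by split => //; rewrite gt_eqF.
have iM : d 0 i <= sigma_max A.
  (* The sum of the diagonal is a crude upper bound of all singular values, which makes the supremum
     meaningful. *)
  apply: ub_le_sup => //; exists (\sum_j d 0 j) => s ss.
  have [->|s0] := eqVneq s 0.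
    by apply: sumr_ge0 => j _; case: Asvd => _ _ /(_ j) /ltW.
  have [j ->] := singular_value_mem Asvd ss s0.
  rewrite (bigD1 j) //= lerDl; apply: sumr_ge0 => l _.
  by case: Asvd => _ _ /(_ l) /ltW.
have M0 : 0 < sigma_max A by apply: lt_le_trans iM.
apply/andP; split; first by rewrite divr_ge0 ?sqr_ge0 // ltW.
rewrite ler_pdivrMr // expr2.
by rewrite ler_pM // (le_trans mi).
Qed.

(** * Rank-one perturbations that stay in [Omega] *)

Lemma near_unitary_lower (R : realType) k (M Q : 'M[R[i]]_k) (eps : R) z :
  Q \is unitarymx -> spectral_norm (M - Q) <= eps ->
  (1 - eps) * l2norm z <= l2norm (M *m z).
Proof.
move=> QU MQ.
(* [Q] preserves norms and differs from [M] by at most [eps]: a reverse triangle inequality. *)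
have Qz : Q *m z = M *m z + (-1)%:C *: ((M - Q) *m z).
  by rewrite rmorphN1 scaleN1r mulmxBl opprB addrC subrK.
have := l2normD (M *m z) ((-1)%:C *: ((M - Q) *m z)).
rewrite -Qz l2normZ normrN1 mul1r l2norm_isom; last exact: unitarymx_cols.
have : l2norm ((M - Q) *m z) <= eps * l2norm z.
  by apply: le_trans (l2norm_mulmx_le _ _) _; rewrite ler_wpM2r ?l2norm_ge0.
lra.
Qed.

Lemma kernel_unit_vector (R : realType) n s (X : 'M[R[i]]_(n, s)) :
  (s < n)%N -> exists y : 'cV[R[i]]_n, X^t* *m y = 0 /\ l2norm y = 1.
Proof.
move=> sn.
(* More rows than columns leave a nonzero row [v] with v X = 0; its normalised adjoint is the vector
   sought. *)
have /rowV0Pn[v /sub_kermxP vX v0] : kermx X != 0.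
  rewrite -mxrank_eq0 mxrank_ker -lt0n subn_gt0.
  exact: leq_ltn_trans (rank_leq_col _) sn.
have y0 : 0 < l2norm (v^t*).
  rewrite lt0r l2norm_ge0 andbT; apply: contra_neq v0 => /l2norm_eq0 vE.
  by rewrite -[v]trmxCK vE linear0 map_mx0.
exists (((l2norm (v^t*))^-1)%:C *: v^t*); split.
  by rewrite -scalemxAr -trmxC_mul vX linear0 map_mx0 scaler0.
by rewrite l2normZ ger0_norm ?invr_ge0 ?l2norm_ge0 // mulVf ?gt_eqF.
Qed.

Lemma diag_real_trmxC (R : realType) k (d : 'rV[R]_k) :
  (diag_mx (map_mx (real_complex R) d))^t* = diag_mx (map_mx (real_complex R) d).
Proof.
rewrite tr_diag_mx map_diag_mx; congr diag_mx.
by apply/rowP => i; rewrite !mxE; exact: conjc_real.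
Qed.

Lemma l2norm_mul_cV1 (R : realType) n (y : 'cV[R[i]]_n) (w : 'cV[R[i]]_1) :
  l2norm (y *m w) = l2norm y * l2norm w.
Proof.
apply/eqP; rewrite -(@eqrXn2 _ 2) ?mulr_ge0 ?l2norm_ge0 //; apply/eqP/complexI.
rewrite -cdotxx cdotMl mulmxA [_ *m y]mx11_scalar -/(cdot y y) mul_scalar_mx.
by rewrite cdotZr !cdotxx exprMn [RHS]rmorphM.
Qed.

Lemma perturbation_in_Omega (R : realType) n k s (F : 'M[R[i]]_n)
    (U V : 'M[R[i]]_(n, k)) (d : 'rV[R]_k) (X : 'M[R[i]]_(n, s)) (i : 'I_k)
    (y : 'cV[R[i]]_n) (eps c ca sa cb sb : R) :
  slim_svd F U d V -> (forall j, c <= d 0 j) ->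
  X^t* *m y = 0 -> l2norm y < c -> l2norm y <= sa * (c - l2norm y) ->
  0 < ca -> 0 <= sa -> 0 < cb -> 0 <= sb ->
  ca ^+ 2 + sa ^+ 2 = 1 -> cb ^+ 2 + sb ^+ 2 = 1 ->
  (forall z, cb * l2norm z <= l2norm (U^t* *m V *m z)) ->
  0 <= eps -> eps < 1 -> 1 - eps = ca * cb - sa * sb ->
  Omega k F X eps
    (U *m (V *m diag_mx (map_mx (real_complex R) d) + y *m delta_mx 0 i)^t*).
Proof.
move=> [UU VV d0 FE] cd Xy yc ysa ca0 sa0 cb0 sb0 ca1 cb1 UV e0 e1 eE.
set D := diag_mx _ in FE *; set C := V *m D + _.
have c0 : 0 < c by apply: le_lt_trans yc; exact: l2norm_ge0.
pose q0 (z : 'cV[R[i]]_k) : 'cV[R[i]]_n := y *m (delta_mx 0 i *m z).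
have Cz (z : 'cV[R[i]]_k) : C *m z = V *m (D *m z) + q0 z.
  by rewrite mulmxDl -!mulmxA.
have q0z z : l2norm (q0 z) <= l2norm y * l2norm z.
  rewrite l2norm_mul_cV1 ler_wpM2l ?l2norm_ge0 //.
  have -> : delta_mx 0 i = (delta_mx i 0 : 'cV[R[i]]_k)^t*.
    by rewrite trmx_delta map_delta_mx.
  apply: coisom_contract; rewrite /orthonormal_cols trmx_delta map_delta_mx.
  by rewrite mul_delta_mx [RHS]mx11_scalar; apply/matrixP => a b; rewrite !ord1 !mxE.
(* [V *m D] stretches by at least [c], and the rank-one term takes away at most the norm of [y]. *)
have Cc z : (c - l2norm y) * l2norm z <= l2norm (C *m z).
  have := l2normD (C *m z) ((-1)%:C *: q0 z).
  rewrite l2normZ normrN1 mul1r rmorphN1 scaleN1r Cz addrK l2norm_isom //.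
  have := q0z z; have := l2norm_diag_ge z (ltW c0) cd; rewrite -/D; lra.
have Cpos : 0 < c - l2norm y by rewrite subr_gt0.
have [P [B [dA [PU Asvd]]]] := slim_svd_factor UU Cpos Cc.
split; first exact: slim_svd_rank Asvd.
split.
  have DC : D^t* = D by exact: diag_real_trmxC.
  rewrite FE -!mulmxA; congr (U *m _).
  rewrite /C linearD /= map_mxD !trmxC_mul DC mulmxDl -!mulmxA.
  have -> : y^t* *m X = (X^t* *m y)^t* by rewrite trmxC_mul trmxCK.
  by rewrite Xy linear0 map_mx0 mulmx0 addr0.
exists (U *m P^t*), dA, (C *m B); split => //.
case: Asvd => UP CB _ _.
have PP := unitarymx_cols PU.
(* The unitary [P] does not change norms, so the angle can be measured against [U] itself. *)
have ME z : l2norm ((U *m P^t*)^t* *m (C *m B) *m z) =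
    l2norm (U^t* *m (C *m (B *m z))).
  by rewrite trmxC_mul trmxCK -(l2norm_isom (U^t* *m _) PP) !mulmxA.
have CBz z : l2norm (C *m (B *m z)) = l2norm z.
  by rewrite mulmxA l2norm_isom.
apply: (near_unitary e0 e1) => z.
  rewrite ME -(CBz z) eE; move: (B *m z) => w.
  (* The vector C w is split into its projection [p] on the column space of [V] and the residual
     [q]. *)
  pose p := V *m (V^t* *m (C *m w)); pose q := C *m w - p.
  have -> : C *m w = p + q by rewrite addrC subrK.
  have Vq : V^t* *m q = 0 by rewrite mulmxBr !mulmxA VV mul1mx subrr.
  apply: coisom_angle => //.
  - by rewrite /p cdotMl Vq /cdot mulmx0 mxE.
  - rewrite addrC subrK.
    (* [V *m (D *m w)] lies in the column space of [V], so only the rank-one term contributes to the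
       residual. *)
    have qE : q = q0 w - V *m (V^t* *m q0 w).
      rewrite /q /p Cz !mulmxDr (mulmxA (V^t*) V) VV mul1mx opprD addrACA.
      by rewrite subrr add0r.
    have qq : l2norm q <= l2norm (q0 w).
      by rewrite qE coisom_residual.
    apply: le_trans qq _; apply: le_trans (q0z _) _.
    apply: le_trans (_ : sa * (c - l2norm y) * l2norm w <= _).
      by rewrite ler_wpM2r ?l2norm_ge0.
    by rewrite -mulrA ler_wpM2l.
  - by rewrite /p l2norm_isom // [in leRHS]mulmxA.
by rewrite ME -[leRHS]CBz coisom_contract.
Qed.

(** * The diameter bound *)

Lemma le_diameter (R : realType) m n (S : set 'M[R[i]]_(m, n)) A B :
  S A -> S B -> ((spectral_norm (A - B))%:E <= diameter S)%E.
Proof. by move=> SA SB; apply: ereal_sup_ubound; exists (A, B). Qed.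

Lemma acos_lt (R : realType) (x y : R) :
  -1 <= x -> x < y -> y <= 1 -> acos y < acos x.
Proof.
move=> x1 xy y1.
have [xI yI] : -1 <= x <= 1 /\ -1 <= y <= 1 by lra.
by rewrite -ltr_cos ?in_itv /= ?acos_ge0 ?acos_lepi // !acosK ?in_itv.
Qed.

Theorem theorem5 (R : realType) (n k s : nat) (delta epsilon : R)
    (F : 'M[R[i]]_n) (X : 'M[R[i]]_(n, s)) :
  (1 <= k)%N ->
  0 <= delta -> delta <= epsilon -> epsilon < 1 ->
  near_symmetric k delta F ->
  (k <= s)%N -> (s < n)%N ->
  orthonormal_cols X ->
  \rank (F *m X) = k ->
  ((2 * (sigma_min F ^+ 2 / sigma_max F) *
     ((acos (1 - epsilon) - acos (1 - delta)) /
      (pi / 2 + acos (1 - epsilon) - acos (1 - delta))))%:E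
   <= diameter (Omega k F X epsilon))%E.
Proof.
move=> k1 de0 de e1 [rF [U [d [V [Fsvd [Q [QU Qd]]]]]]] _ sn _ _.
have i : 'I_k by exact: Ordinal k1.
have cd j := sigma_ratio_bounds j Fsvd.
have e0 : 0 <= epsilon by exact: le_trans de.
set c := sigma_min F ^+ 2 / sigma_max F in cd *.
have c0 : 0 <= c by have /andP[] := cd i.
have {}cd j : c <= d 0 j by have /andP[] := cd j.
have dI : -1 <= 1 - delta <= 1 by lra.
have eI : -1 <= 1 - epsilon <= 1 by lra.
set b := acos (1 - delta); set a0 := acos (1 - epsilon).
have b0 : 0 <= b by exact: acos_ge0.
have ba : b <= a0.
  move: (de); rewrite le_eqVlt => /predU1P[dE|dlt]; first by rewrite /b /a0 dE.
  by apply/ltW/acos_lt; lra.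
have a0p : a0 < pi / 2 by rewrite -acos0; apply: acos_lt; lra.
pose a := a0 - b.
have -> : pi / 2 + a0 - b = pi / 2 + a by rewrite /a addrA.
rewrite -/a.
have aI : 0 <= a < pi / 2 by rewrite /a; lra.
have pa : 0 < pi / 2 + a by lra.
(* [t] solves t = (2 a / pi) (c - t), the largest length of [y] that Jordan's inequality permits;
   the bound to prove is 2 t. *)
pose t := c * (a / (pi / 2 + a)).
have -> : 2 * c * (a / (pi / 2 + a)) = 2 * t by rewrite -mulrA.
have t0 : 0 <= t by apply: mulr_ge0 => //; apply: divr_ge0; lra.
(* For t = 0, which includes delta = epsilon, it is enough that [Omega] contains [F]: an empty set
   would have diameter -oo. Otherwise [c] is positive. *)
have [tz|tn0] := eqVneq t 0.
  have OF : Omega k F X epsilon F.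
    split=> //; split=> //; exists U, d, V; split=> //; exists Q; split=> //.
    exact: le_trans de.
  apply: le_trans (le_diameter OF OF); rewrite lee_fin tz mulr0.
  by apply: le_trans (le_spectral_norm (x := 0) _ _); rewrite ?l2norm0 ?l2norm_ge0.
have cgt0 : 0 < c.
  by rewrite lt0r c0 andbT; apply: contra_neq tn0 => cz; rewrite /t cz mul0r.
have tE : c - t = c * ((pi / 2) / (pi / 2 + a)) by rewrite /t; field; lra.
have tc : t < c.
  by rewrite -subr_gt0 tE mulr_gt0 // divr_gt0 //; lra.
(* Jordan's inequality for sin, multiplied by c / (pi / 2 + a). *)
have ts : t <= sin a * (c - t).
  have j : a <= sin a * (pi / 2) by apply: jordan_sin; lra.
  rewrite tE [leRHS]mulrCA [sin a * _]mulrA ler_wpM2l // ler_wpM2r // invr_ge0.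
  lra.
have UV z : (1 - delta) * l2norm z <= l2norm (U^t* *m V *m z).
  exact: near_unitary_lower QU Qd.
have [y [Xy y1]] := kernel_unit_vector X sn.
pose A (r : R) := U *m (V *m diag_mx (map_mx (real_complex R) d) +
  (r%:C *: y) *m delta_mx 0 i)^t*.
have OA r : `|r| = t -> Omega k F X epsilon (A r).
  move=> rt; have ry : l2norm (r%:C *: y) = t by rewrite l2normZ y1 mulr1.
  apply: (@perturbation_in_Omega _ _ _ _ _ _ _ _ _ _ _ _
    c (cos a) (sin a) (1 - delta) (sin b)); rewrite ?ry //.
  - by rewrite -scalemxAr Xy scaler0.
  - by apply: cos_gt0_pihalf; lra.
  - by apply: sin_ge0_pi; have := @pi_gt0 R; lra.
  - lra.
  - by apply: sin_ge0_pi; rewrite acos_ge0 // acos_lepi.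
  - exact: cos2Dsin2.
  - by rewrite -[1 - delta]acosK ?in_itv // cos2Dsin2.
  (* a + b = acos (1 - epsilon), so the cosine addition formula gives 1 - epsilon. *)
  - rewrite -[1 - epsilon]acosK ?in_itv // -/a0.
    rewrite -[in X in _ = _ * X - _](@acosK _ (1 - delta)) ?in_itv // -/b.
    by rewrite -cosD /a subrK.
have OAt : Omega k F X epsilon (A t) by apply: OA; rewrite ger0_norm.
have OANt : Omega k F X epsilon (A (- t)) by apply: OA; rewrite normrN ger0_norm.
apply: le_trans (le_diameter OAt OANt); rewrite lee_fin.
have AB : A t - A (- t) = U *m ((2 * t)%:C *: (y *m delta_mx 0 i))^t*.
  rewrite /A -mulmxBr -map_mxB -linearB opprD addrACA subrr add0r.
  by rewrite -mulmxBl -scalerBl -rmorphB opprK -scalemxAl mulr_natl mulr2n.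
have UU : orthonormal_cols U by case: Fsvd.
(* The unit vector [y] is sent by the difference to 2 t times the [i]-th column of [U], of norm 2
   t. *)
suff -> : 2 * t = l2norm ((A t - A (- t)) *m y) by apply: le_spectral_norm; rewrite y1.
have ZC (W : 'M[R[i]]_(n, k)) : ((2 * t)%:C *: W)^t* = (2 * t)%:C *: W^t*.
  by apply/matrixP => l j; rewrite !mxE rmorphM; congr (_ * _); exact: conjc_real.
rewrite AB -mulmxA l2norm_isom // ZC -scalemxAl l2normZ ger0_norm ?(mulr_ge0 _ t0) //.
rewrite trmxC_mul -mulmxA [_ *m y]mx11_scalar -/(cdot y y) cdotxx y1 expr1n.
by rewrite mulmx1 trmx_delta map_delta_mx l2norm_delta mulr1.
Qed.
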